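(* Let $X$ be the wreath product $\mathbb{Z}\wr\mathbb{Z}$ equipped with the left-invariant word metric. Then $\operatorname{trasdim}(X)\le \omega+1$, where $\omega$ is the first infinite ordinal. Consequently, $\mathbb{Z}\wr\mathbb{Z}$ has asymptotic property C.
   Context: $\mathbb{N}$ denotes the set of positive integers. **Wreath product and metric.** $\bigoplus_{\mathbb{Z}}\mathbb{Z}$ is the additive group of finitely supported functions $f:\mathbb{Z}\to\mathbb{Z}$. The group $\mathbb{Z}$ acts on it by $a(f)(x)=f(x-a)$. The wreath product $\mathbb{Z}\wr\mathbb{Z}$ is the semidirect product $\left(\bigoplus_{\mathbb{Z}}\mathbb{Z}\right)\rtimes\mathbb{Z}$, with product $(f,a)(g,b)=(f+a(g),a+b)$. It is generated by the two elements $(\delta,0)$ and $(e,1)$, where $e$ is the zero function, $\delta(0)=1$ and $\delta(x)=0$ for $x\ne 0$. For a group $G$ with finite generating set $S$, $|g|_S$ is the length of a shortest word in $S\cup S^{-1}$ representing $g$, and the left-invariant word metric is $d(g,h)=|g^{-1}h|_S$. The word metric on $\mathbb{Z}\wr\mathbb{Z}$ is taken with respect to the generating set $\{(\delta,0),(e,1)\}$. **Families of subsets.** Let $(X,d)$ be a metric space and $\mathcal{U}$ a family of subsets of $X$. For $U,V\subseteq X$, $d(U,V)=\inf\{d(x,y):x\in U,y\in V\}$. For $R>0$, $\mathcal{U}$ is $R$-bounded if $\operatorname{diam}U\le R$ for all $U\in\mathcal{U}$; it is uniformly bounded if it is $R$-bounded for some $R>0$. For $r>0$, $\mathcal{U}$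 is $r$-disjoint if $d(U,V)\ge r$ for all $U,V\in\mathcal{U}$ with $U\ne V$. **Asymptotic property C.** $X$ has asymptotic property C if for every sequence $R_0<R_1<\cdots$ of positive real numbers there exist $n\in\mathbb{N}$ and uniformly bounded families $\mathcal{U}_0,\dots,\mathcal{U}_n$ of subsets of $X$ such that each $\mathcal{U}_i$ is $R_i$-disjoint and $\bigcup_{i=0}^n\mathcal{U}_i$ covers $X$. **Transfinite asymptotic dimension.** Let $\mathrm{Fin}\,\mathbb{N}$ be the collection of all finite nonempty subsets of $\mathbb{N}$. For $M\subseteq\mathrm{Fin}\,\mathbb{N}$ and $a\in\mathbb{N}$ put $M^{a}=\{\tau\in\mathrm{Fin}\,\mathbb{N}: \tau\cup\{a\}\in M,\ a\notin\tau\}$. Define $\operatorname{Ord}M$ (an ordinal or $\infty$) inductively: $\operatorname{Ord}M=0$ iff $M=\varnothing$; for an ordinal $\alpha>0$, $\operatorname{Ord}M\le\alpha$ iff $\operatorname{Ord}M^{a}<\alpha$ for every $a\in\mathbb{N}$; $\operatorname{Ord}M=\alpha$ iff $\operatorname{Ord}M\le\alpha$ and $\operatorname{Ord}M<\alpha$ is not true; $\operatorname{Ord}M=\infty$ iff $\operatorname{Ord}M\le\alpha$ holds for no ordinal $\alpha$. For a metric space $(X,d)$, let $A(X,d)$ be the set of all $\sigma\in\mathrm{Fin}\,\mathbb{N}$ for which there are no uniformly bounded families $\mathcal{U}_i$ ($i\in\sigma$) of subsets of $X$ such that each $\mathcal{U}_i$ is $i$-disjoint and $\bigcup_{i\in\sigma}\mathcal{U}_i$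 covers $X$. Then $\operatorname{trasdim}(X)=\operatorname{Ord}A(X,d)$. *)

(* Defs.v *)
From HB Require Import structures.
From mathcomp Require Import all_boot all_order all_algebra finmap.
From mathcomp Require Import all_classical all_reals all_analysis.

Set Implicit Arguments.
Unset Strict Implicit.
Unset Printing Implicit Defensive.

Import Order.TTheory GRing.Theory Num.Theory.
Local Open Scope classical_set_scope.
Local Open Scope ring_scope.

Section Families.
Context {R : realType} {X : metricType R}.
Implicit Types (U V : set X) (F : set (set X)).

(* The distance to the empty set is [+oo] and the diameter of the empty set is
   [-oo], so the empty set may occur in a disjoint or bounded family. *)
Definition set_dist U V : \bar R :=
  ereal_inf [set (mdist x y)%:E | x in U & y in V].

Definition diam U : \bar R :=
  ereal_sup [set (mdist x y)%:E | x in U & y in U].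

Definition bounded_family (B : R) F := forall U, F U -> (diam U <= B%:E)%E.

Definition uniformly_bounded F := exists2 B : R, 0 < B & bounded_family B F.

Definition disjoint_family (r : R) F :=
  forall U V, F U -> F V -> U <> V -> (r%:E <= set_dist U V)%E.

End Families.

Definition asymptotic_property_C (R : realType) (X : metricType R) : Prop :=
  forall r : nat -> R,
    (forall i, 0 < r i) -> (forall i, r i < r i.+1) ->
    exists2 n : nat, (0 < n)%N &
    exists U : 'I_n.+1 -> set (set X),
      [/\ forall i, uniformly_bounded (U i),
          forall i : 'I_n.+1, disjoint_family (r i) (U i)
        & \bigcup_i \bigcup_(V in U i) V = [set: X]].

(* [OSup f] stands for the least ordinal strictly above all the [f i]. Every
   ordinal has such a presentation; presentations of the same ordinal are
   identified only up to [ole] in both directions. *)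
Inductive ord : Type := OSup (T : Type) (f : T -> ord).

Fixpoint ole (a b : ord) {struct a} : Prop :=
  let: OSup T f := a in let: OSup J g := b in
  forall i : T, exists j : J, ole (f i) (g j).

Definition olt (a b : ord) : Prop :=
  let: OSup J g := b in exists j : J, ole a (g j).

Definition ozero : ord := OSup (of_void ord).
Definition osucc (a : ord) : ord := OSup (fun _ : unit => a).
Definition onat (n : nat) : ord := iter n osucc ozero.
Definition omega : ord := OSup onat.

Lemma ole_refl a : ole a a.
Proof. by elim: a => T f IH i; exists i; exact: IH. Qed.

Lemma ole_trans b a c : ole a b -> ole b c -> ole a c.
Proof.
elim: a b c => I f IH [J g] [K h] /= fg gh i.
have [j fgj] := fg i; have [k ghk] := gh j.
by exists k; exact: IH fgj ghk.
Qed.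

Lemma ole_zero a : ole ozero a.
Proof. by case: a => I f []. Qed.

Lemma ole_lt_trans b a c : ole a b -> olt b c -> olt a c.
Proof. by case: c => K h ab [k bk]; exists k; exact: ole_trans ab bk. Qed.

Lemma olt_le_trans b a c : olt a b -> ole b c -> olt a c.
Proof.
case: b c => [J g] [K h] [j aj] /(_ j)[k gk].
by exists k; exact: ole_trans aj gk.
Qed.

Lemma olt_irr a : ~ olt a a.
Proof.
elim: a => I f IH [i fi]; apply: (IH i).
by apply: olt_le_trans fi; exists i; exact: ole_refl.
Qed.

(* The nonempty finite sets of positive integers. *)
Definition FinN : set {fset nat} :=
  [set t | t != fset0 /\ 0%N \notin t].

Definition link (M : set {fset nat}) (a : nat) : set {fset nat} :=
  [set t | [/\ FinN t, M (a |` t)%fset & a \notin t]].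

(* [Ord_le M al] means "Ord M <= al" for M a subset of [FinN]. The phrase
   "Ord M^a < al" says that Ord M^a is an ordinal smaller than [al], that is
   Ord M^a <= be for some be < al; here M^a is [link M a]. *)
Inductive Ord_le (M : set {fset nat}) (al : ord) : Prop :=
| Ord_le_zero of ole al ozero & M = set0
| Ord_le_pos of olt ozero al &
    (forall a : nat, (0 < a)%N ->
       exists2 be, olt be al & Ord_le (link M a) be).

Lemma Ord_le_zeroE (M : set {fset nat}) : Ord_le M ozero <-> M = set0.
Proof.
split=> [|M0]; last by apply: Ord_le_zero => //; exact: ole_refl.
by case=> // -[[]].
Qed.

Lemma Ord_le_posE (M : set {fset nat}) (al : ord) : olt ozero al ->
  Ord_le M al <->
  forall a : nat, (0 < a)%N ->
    exists2 be, olt be al & Ord_le (link M a) be.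
Proof.
move=> al0; split=> [|H]; last exact: Ord_le_pos.
by case=> // al_le _; case: (olt_irr (olt_le_trans al0 al_le)).
Qed.

(* The set A(X, d); the transfinite asymptotic dimension of X is Ord A(X, d). *)
Definition no_cover (R : realType) (X : metricType R) : set {fset nat} :=
  [set s | FinN s /\
    ~ exists U : nat -> set (set X),
        [/\ forall i, i \in s -> uniformly_bounded (U i),
            forall i, i \in s -> disjoint_family i%:R (U i)
          & \bigcup_(i in [set` s]) \bigcup_(V in U i) V = [set: X]]].

Definition trasdim_le (R : realType) (X : metricType R) (al : ord) : Prop :=
  Ord_le (no_cover X) al.

Section WordLength.
Local Open Scope group_scope.
Variable G : groupType.
Implicit Types (S w : seq G) (g h : G).

Definition is_word S w g :=
  all (fun x => x \in S ++ [seq y^-1 | y <- S]) w /\ \prod_(x <- w) x = g.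

Definition generates S := forall g, exists w, is_word S w g.

Lemma is_word_cat S v w g h :
  is_word S v g -> is_word S w h -> is_word S (v ++ w) (g * h).
Proof.
by move=> [Sv <-] [Sw <-]; rewrite /is_word all_cat Sv Sw big_cat.
Qed.

Lemma is_word_inv S w g :
  is_word S w g -> is_word S (rev [seq x^-1 | x <- w]) g^-1.
Proof.
move=> [Sw <-]; split.
  rewrite all_rev all_map; apply: sub_all Sw => x /=; rewrite !mem_cat.
  case/orP => [Sx|/mapP[y Sy ->]]; last by rewrite invgK Sy.
  by rewrite map_f ?orbT.
elim: w {Sw} => [|x w IH]; first by rewrite !big_nil invg1.
by rewrite /= rev_cons big_rcons/= IH big_cons invgM.
Qed.

Variables (S : seq G) (gen : generates S).

Fact word_length_subproof g : exists n,
  `[< exists2 w, size w = n & is_word S w g >].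
Proof. by have [w Sw] := gen g; exists (size w); apply/asboolP; exists w. Qed.

Definition word_length g : nat := ex_minn (word_length_subproof g).

Lemma word_length_ex g : exists2 w, size w = word_length g & is_word S w g.
Proof. by rewrite /word_length; case: ex_minnP => n /asboolP. Qed.

Lemma word_length_le w g : is_word S w g -> (word_length g <= size w)%N.
Proof.
move=> Sw; rewrite /word_length; case: ex_minnP => n _; apply.
by apply/asboolP; exists w.
Qed.

Lemma word_length1 : word_length 1 = 0%N.
Proof.
apply/eqP; rewrite -leqn0; apply: (@word_length_le [::]).
by split; rewrite ?big_nil.
Qed.

Lemma word_length_eq0 g : word_length g = 0%N -> g = 1.
Proof.
have [w <- [_ <-]] := word_length_ex g.
by move/eqP; rewrite size_eq0 => /eqP ->; rewrite big_nil.
Qed.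

Lemma word_lengthM g h : (word_length (g * h) <= word_length g + word_length h)%N.
Proof.
have [v <- Sv] := word_length_ex g; have [w <- Sw] := word_length_ex h.
by rewrite -size_cat; apply: word_length_le; exact: is_word_cat.
Qed.

Lemma word_lengthV g : word_length g^-1 = word_length g.
Proof.
suff le h : (word_length h^-1 <= word_length h)%N.
  by apply/eqP; rewrite eqn_leq le/=; have := le g^-1; rewrite invgK.
have [w <- /is_word_inv Sw] := word_length_ex h.
by rewrite (leq_trans (word_length_le Sw))// size_rev size_map.
Qed.

End WordLength.

(* The group [G] with the left-invariant word metric given by the generating
   list [S]; [R] is the type of values of the distance. *)
Definition word_space (R : realType) (G : groupType) (S : seq G)
  (gen : generates S) : Type := G.

Section WordMetric.
Variables (R : realType) (G : groupType) (S : seq G) (gen : generates S).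
Let X := word_space R gen.

HB.instance Definition _ := Choice.copy X G.

Definition word_dist (g h : X) : R :=
  (word_length gen ((g : G)^-1 * (h : G))%g)%:R.

Lemma word_distxx g : word_dist g g = 0.
Proof. by rewrite /word_dist mulVg word_length1. Qed.

Lemma word_dist_eq0 g h : word_dist g h = 0 -> g = h.
Proof.
move/eqP; rewrite pnatr_eq0 => /eqP/word_length_eq0 gh.
by apply: (@mulgI G (g : G)^-1%g); rewrite gh mulVg.
Qed.

Lemma word_dist_sym g h : word_dist g h = word_dist h g.
Proof. by rewrite /word_dist -word_lengthV invgM invgK. Qed.

Lemma word_dist_triangle h g k :
  word_dist g k <= word_dist g h + word_dist h k.
Proof.
rewrite -natrD ler_nat; apply: leq_trans (word_lengthM _ _ _).
by rewrite -mulgA mulVKg.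
Qed.

HB.instance Definition _ := @isMetric.Build R X
  word_dist word_distxx word_dist_eq0 word_dist_sym word_dist_triangle.

End WordMetric.

Definition dsumZ : Type := {fsfun int -> int with 0}.

HB.instance Definition _ := Choice.copy dsumZ {fsfun int -> int with 0}.

Section DirectSum.
Implicit Types f g : dsumZ.

Definition dsum0 : dsumZ := [fsfun].

Definition dsum_opp f : dsumZ := [fsfun x in finsupp f => - f x].

Definition dsum_add f g : dsumZ :=
  [fsfun x in (finsupp f `|` finsupp g)%fset => f x + g x].

Lemma dsum_dflt f x : x \notin finsupp f -> f x = 0.
Proof. exact: fsfun_dflt. Qed.

Lemma dsumP f g : f =1 g -> f = g.
Proof. by move=> fg; apply/fsfunP. Qed.

Lemma dsum0E x : dsum0 x = 0.
Proof. by rewrite fsfunE. Qed.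

Lemma dsum_oppE f x : dsum_opp f x = - f x.
Proof.
rewrite [LHS]fsfunE; case: ifPn => // xf.
by rewrite dsum_dflt// oppr0.
Qed.

Lemma dsum_addE f g x : dsum_add f g x = f x + g x.
Proof.
rewrite [LHS]fsfunE in_fsetU; case: ifPn => //.
by rewrite negb_or => /andP[xf xg]; rewrite !dsum_dflt// addr0.
Qed.

Fact dsum_addA : associative dsum_add.
Proof. by move=> f g h; apply: dsumP => x; rewrite !dsum_addE addrA. Qed.

Fact dsum_addC : commutative dsum_add.
Proof. by move=> f g; apply: dsumP => x; rewrite !dsum_addE addrC. Qed.

Fact dsum_add0 : left_id dsum0 dsum_add.
Proof. by move=> f; apply: dsumP => x; rewrite !dsum_addE dsum0E add0r. Qed.

Fact dsum_addN : left_inverse dsum0 dsum_opp dsum_add.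
Proof.
by move=> f; apply: dsumP => x; rewrite dsum_addE dsum_oppE dsum0E addNr.
Qed.

HB.instance Definition _ :=
  GRing.isZmodule.Build dsumZ dsum_addA dsum_addC dsum_add0 dsum_addN.

Lemma dsumZ0E x : (0 : dsumZ) x = 0. Proof. exact: dsum0E. Qed.
Lemma dsumZDE f g x : (f + g) x = f x + g x. Proof. exact: dsum_addE. Qed.
Lemma dsumZNE f x : (- f) x = - f x. Proof. exact: dsum_oppE. Qed.

(* The action of Z on the direct sum: a(f) is written [shift a f]. *)
Definition shift (a : int) f : dsumZ :=
  [fsfun x in [fset (y + a)%R | y in finsupp f]%fset => f (x - a)].

Lemma shiftE a f x : shift a f x = f (x - a).
Proof.
rewrite [LHS]fsfunE; case: ifPn => // xa.
rewrite dsum_dflt//; apply: contra xa => fx.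
by apply/imfsetP; exists (x - a) => //; rewrite subrK.
Qed.

Lemma shift0 f : shift 0 f = f.
Proof. by apply: dsumP => x; rewrite shiftE subr0. Qed.

Lemma shift_shift a b f : shift a (shift b f) = shift (a + b) f.
Proof. by apply: dsumP => x; rewrite !shiftE opprD addrA. Qed.

Lemma shiftD a f g : shift a (f + g) = shift a f + shift a g.
Proof. by apply: dsumP => x; rewrite dsumZDE !shiftE dsumZDE. Qed.

Lemma shiftN a f : shift a (- f) = - shift a f.
Proof. by apply: dsumP => x; rewrite dsumZNE !shiftE dsumZNE. Qed.

Lemma shift00 a : shift a 0 = 0.
Proof. by apply: dsumP => x; rewrite shiftE !dsumZ0E. Qed.

Definition delta : dsumZ := [fsfun x in [fset 0%R]%fset => 1].

Lemma deltaE x : delta x = (x == 0)%:R.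
Proof. by rewrite [LHS]fsfunE in_fset1; case: eqP. Qed.

End DirectSum.

Definition wreathZ : Type := (dsumZ * int)%type.

HB.instance Definition _ := Choice.copy wreathZ (dsumZ * int)%type.

Section Wreath.
Implicit Types u v w : wreathZ.

Definition wr_one : wreathZ := (0, 0).
Definition wr_mul u v : wreathZ := (u.1 + shift u.2 v.1, u.2 + v.2).
Definition wr_inv u : wreathZ := (- shift (- u.2) u.1, - u.2).

Fact wr_mulA : associative wr_mul.
Proof.
by move=> u v w; rewrite /wr_mul/= shiftD shift_shift !addrA.
Qed.

Fact wr_mul1 : left_id wr_one wr_mul.
Proof. by case=> f a; rewrite /wr_mul/= shift0 !add0r. Qed.

Fact wr_mulr1 : right_id wr_one wr_mul.
Proof. by case=> f a; rewrite /wr_mul/= shift00 !addr0. Qed.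

Fact wr_mulV : left_inverse wr_one wr_inv wr_mul.
Proof. by case=> f a; rewrite /wr_mul/= !addNr. Qed.

Fact wr_mulrV : right_inverse wr_one wr_inv wr_mul.
Proof.
by case=> f a; rewrite /wr_mul/= shiftN shift_shift !subrr shift0 subrr.
Qed.

End Wreath.

HB.instance Definition _ := isGroup.Build wreathZ
  wr_mulA wr_mul1 wr_mulr1 wr_mulV wr_mulrV.

Lemma wr_mulE (u v : wreathZ) : (u * v)%g = (u.1 + shift u.2 v.1, u.2 + v.2).
Proof. by []. Qed.

Lemma wr_invE (u : wreathZ) : (u^-1)%g = (- shift (- u.2) u.1, - u.2).
Proof. by []. Qed.

Definition wr_gens : seq wreathZ := [:: (delta, 0); (0, 1)].

Section WreathGenerated.
Local Open Scope group_scope.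
Let spanned (g : wreathZ) := exists w, is_word wr_gens w g.

Let spanned1 : spanned 1.
Proof. by exists [::]; split; rewrite ?big_nil. Qed.

Let spannedM g h : spanned g -> spanned h -> spanned (g * h).
Proof. by move=> [v Sv] [w Sw]; exists (v ++ w); exact: is_word_cat. Qed.

Let spannedV g : spanned g -> spanned g^-1.
Proof. by move=> [w /is_word_inv Sw]; eexists; exact: Sw. Qed.

Let spanned_gen g : g \in wr_gens -> spanned g.
Proof.
by move=> Sg; exists [:: g]; rewrite /is_word all_seq1 mem_cat Sg big_seq1.
Qed.

Let spannedD (f g : dsumZ) :
  spanned (f, 0%R) -> spanned (g, 0%R) -> spanned ((f + g)%R, 0%R).
Proof.
move=> Sf Sg; have := spannedM Sf Sg; congr spanned.
by rewrite !wr_mulE/= shift0 addr0.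
Qed.

Let spannedN (f : dsumZ) : spanned (f, 0%R) -> spanned ((- f)%R, 0%R).
Proof.
move/spannedV; congr spanned.
by rewrite wr_invE/= oppr0 shift0.
Qed.

Let spanned_nat (n : nat) : spanned (0%R, n%:Z).
Proof.
elim: n => [|n IH]; first exact: spanned1.
have S1 : spanned (0%R, 1%R) by apply: spanned_gen; rewrite !inE eqxx orbT.
have := spannedM S1 IH; congr spanned.
by rewrite !wr_mulE/= shift00 addr0 intS.
Qed.

Let spanned_int (n : int) : spanned (0%R, n).
Proof.
case: n => n; first exact: spanned_nat.
have := spannedV (spanned_nat n.+1); congr spanned.
by rewrite wr_invE/= shift00 oppr0 NegzE.
Qed.

Let spanned_delta (k : int) : spanned ((delta *~ k)%R, 0%R).
Proof.
have Sn n : spanned ((delta *+ n)%R, 0%R).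
  elim: n => [|n IH]; first exact: spanned1.
  by rewrite mulrS; apply: spannedD => //; apply: spanned_gen; rewrite !inE eqxx.
by case: k => n; [exact: Sn|rewrite NegzE mulrNz; apply: spannedN; exact: Sn].
Qed.

Let spanned_shift (a : int) (f : dsumZ) :
  spanned (f, 0%R) -> spanned (shift a f, 0%R).
Proof.
move=> Sf; have := spannedM (spannedM (spanned_int a) Sf) (spanned_int (- a)%R).
congr spanned; rewrite !wr_mulE.
by rewrite shift00 add0r !addr0 subrr.
Qed.

Let dsum_sum (f : dsumZ) :
  f = (\sum_(a <- finsupp f) shift a (delta *~ f a))%R.
Proof.
have mulzE (g : dsumZ) (k : int) x : ((g *~ k) x = g x * k)%R.
  have nE n : ((g *+ n) x = g x *+ n)%R.
    by elim: n => [|n IH]; rewrite ?dsumZ0E ?mulr0n// !mulrS dsumZDE IH.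
  case: k => n; first by rewrite -pmulrn nE -mulr_natr natz.
  by rewrite NegzE mulrNz dsumZNE -pmulrn nE -mulr_natr natz mulrN.
apply: dsumP => x.
rewrite (big_morph (fun g : dsumZ => g x) (fun f g => dsumZDE f g x) (dsumZ0E x)).
under eq_bigr do rewrite shiftE mulzE deltaE subr_eq0.
have [fx|fx] := boolP (x \in finsupp f).
  rewrite (bigD1_seq x)//= eqxx mul1r big1 ?addr0// => y.
  by rewrite eq_sym => /negbTE ->; rewrite mul0r.
rewrite dsum_dflt// big_seq big1// => y fy.
by case: eqP => [xy|]; [rewrite xy fy in fx|rewrite mul0r].
Qed.

Lemma wr_gens_generate : generates wr_gens.
Proof.
case=> f a; suff Sf : spanned (f, 0%R).
  have := spannedM Sf (spanned_int a); congr spanned.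
  by rewrite !wr_mulE/= shift00 addr0 add0r.
rewrite (dsum_sum f).
elim/big_rec: _ => [|b g _ Sg]; first exact: spanned1.
by apply: spannedD => //; apply: spanned_shift; exact: spanned_delta.
Qed.

End WreathGenerated.

(* Main.v *)
Require Import Defs.
From mathcomp Require Import all_boot all_order all_algebra.
From mathcomp Require Import all_classical all_reals all_analysis.
From mathcomp Require Import finmap zify ring.
(* MathComp-Analysis has its own [shift]. *)
Import Defs.

(** It suffices to find, for every scale r, a number m such that for every q the
group is covered by two r-disjoint and m q-disjoint uniformly bounded families.

Cut Z into blocks of length n = 4r. Among the points (f, a) with a at distance
at least r from the ends of its block j, two points at distance less than r
have the same j, and their lamp functions agree outside block j: at scale r one
only moves inside a copy of Z^n. The remaining positions of a are treated by
translating by 2r, which is why two r-disjoint families are needed.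

To cut these copies of Z^n into bounded pieces one removes walls, and the walls
of all copies have to be q-disjoint. Replace f by its cells, f(x) divided by
r + q, so that close points have cell values differing by at most 1. For every
i <= n consider a sum, over all coordinates x, of powers of 3 times the cell
values, where the exponents are distinct on every window of 2q + 1 blocks: then
the sum separates adjacent cells, even modulo a large number P. The i-th walls
of block j are 3^(n+1) consecutive residue classes modulo P, in units of the
weight of block j, starting from an offset depending on j mod (2q + 1). Since one
step inside block j changes the sum by less than 3^(n+1) units, a wall cannot be
jumped over; since the offsets for different blocks are far apart, adjacent
cells belonging to the same wall are equal. The n + 1 sums together determine
the n coordinates of a block, so what remains off the walls is bounded. *)

Set Implicit Arguments.
Unset Strict Implicit.
Unset Printing Implicit Defensive.
Import Order.TTheory GRing.Theory Num.Theory.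
Local Open Scope ring_scope.

(** * Word length in the wreath product *)

Definition len : wreathZ -> nat := word_length wr_gens_generate.

Lemma lenM u v : (len (wr_mul u v) <= len u + len v)%N.
Proof. exact: word_lengthM. Qed.

Lemma lenV u : len (wr_inv u) = len u.
Proof. exact: word_lengthV. Qed.

Lemma wr_mulDl f g a : wr_mul (f, 0) (g, a) = (f + g, a).
Proof. by rewrite /wr_mul /= shift0 add0r. Qed.

(* The carrier of the values of an [fsfun] is not syntactically [int], which
   defeats [lia]. *)
Definition ev (f : dsumZ) (x : int) : int := f x.

Lemma ev_ext f g : ev f =1 ev g -> f = g.
Proof. exact: dsumP. Qed.

Lemma ev0 x : ev 0 x = 0. Proof. exact: dsumZ0E. Qed.
Lemma evD f g x : ev (f + g) x = ev f x + ev g x. Proof. exact: dsumZDE. Qed.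
Lemma evN f x : ev (- f) x = - ev f x. Proof. exact: dsumZNE. Qed.
Lemma ev_shift a f x : ev (shift a f) x = ev f (x - a). Proof. exact: shiftE. Qed.

Lemma ev_delta x : ev delta x = if x == 0 then 1 else 0.
Proof. by rewrite /ev deltaE; case: (x == 0). Qed.

Lemma ev_mulz f (k : int) x : ev (f *~ k) x = ev f x * k.
Proof.
have nE n : ev (f *+ n) x = ev f x *+ n.
  by elim: n => [|n IH]; rewrite ?ev0 ?mulr0n// !mulrS evD IH.
case: k => n; first by rewrite -pmulrn nE -mulr_natr natz.
by rewrite NegzE mulrNz evN -pmulrn nE -mulr_natr natz mulrN.
Qed.

Lemma mem_gens (s : wreathZ) :
  s \in wr_gens ++ [seq y^-1%g | y <- wr_gens] ->
  [\/ s = (delta, 0), s = (0, 1), s = (- delta, 0) | s = (0, - 1)].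
Proof.
have e1 : ((delta, 0%R) : wreathZ)^-1%g = (- delta, 0).
  by rewrite wr_invE; apply: (congr2 (@pair dsumZ int)); rewrite oppr0 ?shift0.
have e2 : ((0%R, 1%R) : wreathZ)^-1%g = (0, - 1).
  by rewrite wr_invE; apply: (congr2 (@pair dsumZ int)); rewrite ?shift00 ?oppr0.
have -> : [seq y^-1%g | y <- wr_gens] = [:: (- delta, 0); (0, - 1)] :> seq wreathZ.
  by rewrite /wr_gens 2!map_cons e1 e2.
rewrite /wr_gens cat_cons cat_cons cat0s.
rewrite 4!in_cons in_nil orbF => /or4P[] /eqP ->;
 [exact: Or41|exact: Or42|exact: Or43|exact: Or44].
Qed.

(** Prepending a letter to a word changes the lamp at 0 by one or moves everything by one position,
    so each bound grows by at most one. *)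
Lemma len_bounds (h : dsumZ) (c : int) :
  [/\ (`|c| <= len (h, c))%N, forall x, (`|ev h x| <= len (h, c))%N &
      forall x, ev h x != 0 -> (`|x| <= len (h, c))%N].
Proof.
rewrite /len; have [w <- [Sw]] := word_length_ex wr_gens_generate (h, c).
elim: w h c Sw => [|s w IH] h c.
  by rewrite big_nil => _ [<- <-]; split=> // x; rewrite ev0.
rewrite [all _ _]/= => /andP[/mem_gens Ss Sw].
rewrite big_cons; case E: (\prod_(x <- w) x)%g => [h' c'].
rewrite wr_mulE => -[<- <-] {h c}.
rewrite (_ : size (s :: w) = (size w).+1)//.
have {IH Sw E} := IH _ _ Sw E; move: (size w) => k [c'k h'k h'0].
case: Ss => -> ; rewrite [(_,_).1]/= [(_,_).2]/=;
  (split; [lia|move=> x; rewrite evD ?evN ev_shift ?ev_delta ?ev0 ?subr0..]).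
- by have := h'k x; case: eqP; lia.
- by have := h'0 x; have [->|_] := eqVneq x 0; lia.
- by rewrite add0r leqW.
- by rewrite add0r => /h'0; lia.
- by have := h'k x; case: eqP; lia.
- by have := h'0 x; have [->|_] := eqVneq x 0; lia.
- by rewrite add0r leqW.
- by rewrite add0r => /h'0; lia.
Qed.

Lemma len_muln (h : dsumZ) (k : nat) : (len (h *+ k, 0%R) <= k * len (h, 0%R))%N.
Proof.
elim: k => [|k IH]; first by rewrite mulr0n /len word_length1.
have -> : (h *+ k.+1, 0) = wr_mul (h, 0) (h *+ k, 0).
  by rewrite wr_mulDl mulrS.
by rewrite mulSn; apply: leq_trans (lenM _ _) _; rewrite leq_add2l.
Qed.

Lemma len_mulz (h : dsumZ) (k : int) : (len (h *~ k, 0%R) <= `|k| * len (h, 0%R))%N.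
Proof.
case: k => k; first exact: len_muln.
rewrite NegzE mulrNz; apply: leq_trans (len_muln _ _).
have -> : (- (h *~ k.+1), 0) = wr_inv (h *+ k.+1, 0).
  by rewrite /wr_inv/= oppr0 shift0.
by rewrite lenV.
Qed.

(** The lamps are set one position at a time, each by repeating the unit lamp there at most [H]
    times. *)
Lemma len_supported (S : seq int) (H : nat) (h : dsumZ) :
  (forall x, x \notin S -> ev h x = 0) -> (forall x, (`|ev h x| <= H)%N) ->
  (len (h, 0%R) <= \sum_(x <- S) H * len (shift x delta, 0%R))%N.
Proof.
elim: S h => [|x S IH] h hS hH.
  rewrite (_ : h = 0) ?/len ?word_length1//.
  by apply: ev_ext => x; rewrite hS// ev0.
pose h1 := shift x delta *~ ev h x.
have h1E y : ev h1 y = if y == x then ev h x else 0.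
  by rewrite ev_mulz ev_shift ev_delta subr_eq0; case: eqP => _; rewrite ?mul1r ?mul0r.
have -> : (h, 0) = wr_mul (h1, 0) (h - h1, 0).
  by rewrite wr_mulDl addrC subrK.
rewrite big_cons; apply: leq_trans (lenM _ _) _; apply: leq_add.
  by apply: leq_trans (len_mulz _ _) _; rewrite leq_mul2r; have := hH x; lia.
apply: IH => y; rewrite evD evN h1E; have [->|yx] := eqVneq y x.
- by rewrite subrr.
- by move=> yS; rewrite subr0 hS// in_cons negb_or yx.
- by rewrite subrr.
- by rewrite subr0.
Qed.

Lemma len_bounded (S : seq int) (H : nat) : exists B : nat,
  forall (h : dsumZ) (c : int), c \in S -> (forall x, x \notin S -> ev h x = 0) ->
  (forall x, (`|ev h x| <= H)%N) -> (len (h, c) <= B)%N.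
Proof.
exists (\sum_(x <- S) H * len (shift x delta, 0%R) +
  \sum_(x <- S) len (0%R, x))%N => h c cS hS hH.
have -> : (h, c) = wr_mul (h, 0) (0, c).
  by rewrite wr_mulDl addr0.
apply: leq_trans (lenM _ _) _; apply: leq_add; first exact: len_supported.
by rewrite (big_rem c)//= leq_addr.
Qed.

(** * The word metric in coordinates *)

Definition gap (u v : wreathZ) : nat := len (wr_mul (wr_inv u) v).

Lemma gapE f a g b :
  gap (f, a) (g, b) = len (shift (- a) (g - f), b - a).
Proof. by rewrite /gap /wr_inv /wr_mul/= addrC shiftD shiftN [RHS]/= [- a + b]addrC. Qed.

Lemma gap_bounds f a g b (N : nat) : (gap (f, a) (g, b) <= N)%N ->
  [/\ (`|(a - b)%R| <= N)%N, forall x, (`|(ev f x - ev g x)%R| <= N)%N &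
      forall x, ev f x != ev g x -> (`|(x - a)%R| <= N)%N].
Proof.
rewrite gapE => gN; have [c h h0] := len_bounds (shift (- a) (g - f)) (b - a).
have hE x : ev (shift (- a) (g - f)) (x - a) = ev g x - ev f x.
  by rewrite ev_shift opprK subrK evD evN.
split=> [|x|x fg].
- by rewrite -abszN opprB; exact: leq_trans gN.
- by rewrite -abszN opprB -hE; exact: leq_trans gN.
- by apply: leq_trans gN; apply: h0; rewrite hE subr_eq0 eq_sym.
Qed.

(** A coarse converse of [gap_bounds]: translation by [- a] puts the support of the difference of
    [f] and [g] into a fixed interval, where [len_bounded] is uniform. *)
Lemma gap_bounded (W H : nat) : exists B : nat, forall f a g b,
  (`|(a - b)%R| <= W)%N -> (forall x, (`|(ev f x - ev g x)%R| <= H)%N) ->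
  (forall x, ev f x != ev g x -> (`|(x - a)%R| <= W)%N) ->
  (gap (f, a) (g, b) <= B)%N.
Proof.
pose S := [seq y%:Z - W%:Z | y <- iota 0 (2 * W).+1].
have memS x : (`|x| <= W)%N -> x \in S.
  by move=> xW; apply/mapP; exists `|(x + W%:Z)%R|%N; rewrite ?mem_iota; lia.
have [B lenB] := len_bounded S H; exists B => f a g b ab fg fga.
have hE x : ev (shift (- a) (g - f)) x = ev g (x + a) - ev f (x + a).
  by rewrite ev_shift opprK evD evN.
rewrite gapE; apply: lenB => [|x xS|x]; first by apply: memS; rewrite -abszN opprB.
  apply/eqP; rewrite hE subr_eq0 eq_sym; apply: contraNT xS => /fga.
  by rewrite addrK; exact: memS.
by rewrite hE -abszN opprB.
Qed.

(** * Coding of cells by sums of powers of three *)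

Lemma big_subseq_support (V : nmodType) (T : eqType) (A B : seq T) (h : T -> V) :
  uniq A -> uniq B -> {subset A <= B} -> (forall x, x \notin A -> h x = 0) ->
  \sum_(x <- B) h x = \sum_(x <- A) h x.
Proof.
move=> uA uB AB h0; rewrite (bigID (mem A))/= [X in _ + X]big1 => [|x]; last exact: h0.
rewrite addr0 -big_filter; apply: perm_big; apply: uniq_perm => [||x] //.
  by rewrite filter_uniq.
by rewrite mem_filter; apply/andP/idP => [[]//|xA]; split=> //; exact: AB.
Qed.

Definition interval (m : int) (k : nat) : seq int :=
  [seq m + y%:Z | y <- iota 0 k].

Lemma mem_interval m k x : (x \in interval m k) = (m <= x < m + k%:Z).
Proof.
apply/mapP/idP => [[y]|xm]; first by rewrite mem_iota => yk ->; lia.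
by exists `|(x - m)%R|%N; rewrite ?mem_iota; lia.
Qed.

Lemma interval_uniq m k : uniq (interval m k).
Proof. by rewrite map_inj_uniq ?iota_uniq// => y z; lia. Qed.

(** In the inductive step the exponents below [N] contribute less than half of 3^N in absolute
    value, so they cannot cancel a nonzero digit at [N]. *)
Lemma ternary_sum (T : eqType) (S : seq T) (E : T -> nat) (d : T -> int) (N : nat) :
  uniq S -> {in S &, injective E} -> (forall x, x \in S -> (E x < N)%N) ->
  (forall x, x \in S -> -1 <= d x <= 1) ->
  - 3 ^+ N < 2 * (\sum_(x <- S) 3 ^+ E x * d x) < 3 ^+ N /\
  (\sum_(x <- S) 3 ^+ E x * d x = 0 -> forall x, x \in S -> d x = 0).
Proof.
elim: N S => [|N IH] S uS injE EN d1.
  case: S EN {uS injE d1} => [|x S EN]; first by rewrite big_nil.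
  by have := EN x (mem_head _ _).
have [[x xS Ex]|nE] := pselect (exists2 x, x \in S & E x = N); last first.
  have [//|lt z] := IH S uS injE _ d1.
    move=> x xS; have := EN x xS; rewrite ltnS leq_eqVlt => /orP[/eqP Ex|//].
    by case: nE; exists x.
  by split=> //; rewrite exprS; lia.
have [|x1 x2 x1S x2S|y|y|lt z] := IH (rem x S); rewrite ?rem_uniq//.
- by move=> xy; apply: injE => //; apply: mem_rem; eassumption.
- rewrite mem_rem_uniq// !inE => /andP[yx yS].
  have := EN y yS; rewrite ltnS leq_eqVlt => /orP[/eqP Ey|//].
  by move: yx; rewrite (injE y x) ?eqxx// Ex.
- by move/mem_rem; exact: d1.
rewrite (big_rem x)//= Ex exprS; move: lt z; set s := \sum_(_ <- _) _ => lt z.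
have p0 : 0 < 3 ^+ N :> int by rewrite exprn_gt0.
have := d1 x xS => dx; split; first nia.
move=> s0; have dx0 : d x = 0 by nia.
move: s0; rewrite dx0 mulr0 add0r => /z dS y yS.
have [->//|yx] := eqVneq y x.
by apply: dS; rewrite mem_rem_uniq// !inE yx.
Qed.

(** * Blocks of positions and their digits *)

Section Blocks.
Variable n : nat.
Hypothesis n_gt0 : (0 < n)%N.

Definition blk (x : int) : int := (x %/ n%:Z)%Z.

Definition pos (x : int) : nat := `|(x %% n%:Z)%Z|%N.

(* Swapping the digit of coordinate [i] with the spare digit [n] makes the sums
   for [i] and for [n] differ by a multiple of that coordinate alone. *)
Definition dig (i : nat) (x : int) : nat := if pos x == i then n else pos x.

Definition block (j : int) : seq int := interval (j * n%:Z) n.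

Lemma blkP x j : (blk x == j) = (j * n%:Z <= x < j * n%:Z + n%:Z).
Proof.
have n0 : n%:Z != 0 by lia.
have := divz_eq x n%:Z; have := modz_ge0 x n0; have : (x %% n%:Z)%Z < n%:Z.
  by rewrite ltz_pmod//; lia.
rewrite /blk; move: (x %% _)%Z (x %/ _)%Z => m q mn m0 ->.
apply/eqP/idP => [->|]; [lia|nia].
Qed.

Lemma blk_pos x : x = blk x * n%:Z + (pos x)%:Z /\ (pos x < n)%N.
Proof.
rewrite /blk /pos; have := divz_eq x n%:Z.
have := @modz_ge0 x n%:Z; have := @ltz_pmod x n%:Z; lia.
Qed.

Lemma pos_inj x y : blk x = blk y -> pos x = pos y -> x = y.
Proof.
have [xE _] := blk_pos x; have [yE _] := blk_pos y.
by move=> b p; rewrite xE yE b p.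
Qed.

Lemma mem_block j x : (x \in block j) = (blk x == j).
Proof. by rewrite mem_interval blkP. Qed.

Lemma dig_le i x : (dig i x <= n)%N.
Proof. by have [_] := blk_pos x; rewrite /dig; case: eqP; lia. Qed.

Lemma dig_inj i x y : dig i x = dig i y -> pos x = pos y.
Proof.
have [_ hx] := blk_pos x; have [_ hy] := blk_pos y.
by rewrite /dig; case: eqP => [->|_]; case: eqP => [->|_]; lia.
Qed.

Lemma blk_close (N : nat) a b : (`|(a - b)%R| <= N)%N -> (`|(blk a - blk b)%R| <= N)%N.
Proof.
have [aE an] := blk_pos a; have [bE bn] := blk_pos b.
rewrite {1}aE {1}bE -/(blk a) -/(blk b); move: (blk a) (blk b) (pos a) (pos b) an bn.
move: n n_gt0 => k k0 x y p q pk qk *; nia.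
Qed.

Lemma blk_eq_close a b : blk a = blk b -> (`|(a - b)%R| <= n)%N.
Proof.
have [aE an] := blk_pos a; have [bE bn] := blk_pos b.
by move=> ab; rewrite aE bE -/(blk a) -/(blk b) ab; lia.
Qed.

End Blocks.

Section Cells.
Variable s : nat.
Hypothesis s_gt0 : (0 < s)%N.

Definition cell (f : dsumZ) (x : int) : int := (ev f x %/ s%:Z)%Z.

Lemma cell_adjacent f g x : (`|(ev f x - ev g x)%R| <= s)%N ->
  -1 <= cell f x - cell g x <= 1.
Proof.
rewrite /cell; have s0 : s%:Z != 0 by lia.
have lS m : (m %% s%:Z)%Z < s%:Z by rewrite ltz_pmod//; lia.
move: (divz_eq (ev f x) s%:Z) (divz_eq (ev g x) s%:Z).
move: (lS (ev f x)) (lS (ev g x)) (modz_ge0 (ev f x) s0) (modz_ge0 (ev g x) s0).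
move: (ev f x) (ev g x) (_ %/ _)%Z (_ %/ _)%Z (_ %% _)%Z (_ %% _)%Z.
move: s s_gt0 {s0 lS} => t t0 x1 x2 q q' m m' *; nia.
Qed.

Lemma cell_close (H : nat) f g x : - H%:Z <= cell f x - cell g x <= H%:Z ->
  (`|(ev f x - ev g x)%R| <= H.+1 * s)%N.
Proof.
rewrite /cell; have s0 : s%:Z != 0 by lia.
have lS m : (m %% s%:Z)%Z < s%:Z by rewrite ltz_pmod//; lia.
move: (divz_eq (ev f x) s%:Z) (divz_eq (ev g x) s%:Z).
move: (lS (ev f x)) (lS (ev g x)) (modz_ge0 (ev f x) s0) (modz_ge0 (ev g x) s0).
move: (ev f x) (ev g x) (_ %/ _)%Z (_ %/ _)%Z (_ %% _)%Z (_ %% _)%Z.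
move: s s_gt0 {s0 lS} => t t0 x1 x2 q q' m m' *; nia.
Qed.

End Cells.

(** * Codes and their residues *)

Section Coding.
Variables (n R s : nat).
Hypothesis n_gt0 : (0 < n)%N.
Let K := (2 * R).+1.
Local Notation blk := (blk n).
Local Notation pos := (pos n).
Local Notation dig := (dig n).
Local Notation block := (block n).
Local Notation cell := (cell s).

Definition res (j : int) : nat := `|(j %% K%:Z)%Z|%N.

Definition expo (i : nat) (x : int) : nat := (n.+1 * res (blk x) + dig i x)%N.

Definition code (i : nat) (f : dsumZ) : int :=
  \sum_(x <- finsupp f) 3 ^+ expo i x * cell f x.

Definition window (j : int) : seq int := interval ((j - R%:Z) * n%:Z) (K * n).

Definition lcode (i : nat) (j : int) (f : dsumZ) : int :=
  \sum_(x <- block j) 3 ^+ dig i x * cell f x.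

Definition scale : int := 3 ^+ (n.+1 * K).

(** There is room for [K] offsets spaced by [2 * scale], and the extra 1 makes 3 invertible modulo
    this number. *)
Definition modulus : int := 1 + 2 * K%:Z * scale.

(* As [2 * K * scale] is [-1] modulo [modulus], the second summand is the other
   blocks' share of [code i f], minus the offset of block [j], divided modulo
   [modulus] by the weight [3 ^+ (n.+1 * res j)] of block [j]. *)
Definition tval (i : nat) (j : int) (f : dsumZ) : int :=
  lcode i j f - 2 * K%:Z * 3 ^+ (n.+1 * (K - res j)) *
    (code i f - 3 ^+ (n.+1 * res j) * lcode i j f - 2 * scale * (res j)%:Z).

Lemma mem_window j x : (x \in window j) = (`|(blk x - j)%R| <= R)%N.
Proof.
have [xE xn] := blk_pos n_gt0 x; rewrite mem_interval /K.
apply/idP/idP; nia.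
Qed.

Lemma res_lt j : (res j < K)%N.
Proof. by have := @ltz_pmod j K%:Z; have := @modz_ge0 j K%:Z; rewrite /res /K; lia. Qed.

Lemma res_inj (j j1 j2 : int) : (`|(j1 - j)%R| <= R)%N -> (`|(j2 - j)%R| <= R)%N ->
  res j1 = res j2 -> j1 = j2.
Proof.
have K0 : K%:Z != 0 by [].
move=> h1 h2; have : (`|(j1 - j2)%R| < K)%N by rewrite /K; lia.
rewrite /res; have := divz_eq j1 K%:Z; have := divz_eq j2 K%:Z.
have := modz_ge0 j1 K0; have := modz_ge0 j2 K0.
move: (j1 %/ _)%Z (j2 %/ _)%Z (j1 %% _)%Z (j2 %% _)%Z => q1 q2 m1 m2.
move: K => k m2_ge0 m1_ge0 -> -> qk m12; suff: q1 = q2 by lia.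
have {m12} m12 : m1 = m2 by lia.
by subst m1; nia.
Qed.

(** Division by [n.+1] recovers the digit and the residue of the block, and two blocks of one window
    are less than [K] apart. *)
Lemma expo_inj i (j : int) : {in window j &, injective (expo i)}.
Proof.
move=> x y; rewrite !mem_window => xj yj exy.
have dx := dig_le n_gt0 i x; have dy := dig_le n_gt0 i y.
have [rxy dxy] : res (blk x) = res (blk y) /\ dig i x = dig i y.
  have rxy : res (blk x) = res (blk y).
    have := congr1 (divn^~ n.+1) exy.
    by rewrite /expo /= ![(n.+1 * _)%N]mulnC !divnMDl// !divn_small ?ltnS// !addn0.
  by split=> //; move: exy; rewrite /expo rxy => /addnI.
by apply: (pos_inj n_gt0); [exact: res_inj xj yj rxy|exact: (dig_inj n_gt0 dxy)].
Qed.

Lemma expo_lt i x : (expo i x < n.+1 * K)%N.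
Proof. by have := res_lt (blk x); have := dig_le n_gt0 i x; rewrite /expo; nia. Qed.

Lemma code_sub i (S : seq int) f g : uniq S ->
  (forall x, x \notin S -> ev f x = ev g x) ->
  code i f - code i g = \sum_(x <- S) 3 ^+ expo i x * (cell f x - cell g x).
Proof.
move=> uS fgS; pose A := undup (finsupp f ++ finsupp g ++ S).
have codeA h : {subset finsupp h <= A} ->
    code i h = \sum_(x <- A) 3 ^+ expo i x * cell h x.
  move=> hA; apply/esym/big_subseq_support; rewrite ?fset_uniq ?undup_uniq// => x.
  by rewrite /cell /ev => /dsum_dflt ->; rewrite div0z mulr0.
rewrite (codeA f) ?(codeA g) => [|x xg|x xf]; rewrite ?mem_undup ?mem_cat ?xf ?xg ?orbT//.
rewrite -sumrB -[RHS](@big_subseq_support _ _ _ A) ?undup_uniq//.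
- by apply: eq_bigr => x _; rewrite mulrBr.
- by move=> x xS; rewrite mem_undup !mem_cat xS !orbT.
- by move=> x xS; rewrite /cell fgS// subrr mulr0.
Qed.

Lemma code_sub_block i (j : int) f g : (forall x, blk x != j -> ev f x = ev g x) ->
  code i f - code i g = 3 ^+ (n.+1 * res j) * (lcode i j f - lcode i j g).
Proof.
move=> fg; rewrite (@code_sub i (block j)) ?interval_uniq//; last first.
  by move=> x; rewrite (mem_block n_gt0); exact: fg.
rewrite -sumrB mulr_sumr !big_seq; apply: eq_bigr => x.
rewrite (mem_block n_gt0) => /eqP xj.
by rewrite /expo xj exprD -mulrA mulrBr.
Qed.

Lemma tval_sub i (j : int) f g : (forall x, blk x != j -> ev f x = ev g x) ->
  tval i j f - tval i j g = lcode i j f - lcode i j g.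
Proof.
move=> /(code_sub_block i); rewrite /tval.
move: (code i f) (code i g) => cf cg e.
have -> : cf = cg + 3 ^+ (n.+1 * res j) * (lcode i j f - lcode i j g) by rewrite -e; ring.
by ring.
Qed.

(** Multiplying [tval] by the weight of block [j] produces [scale], and [2 * K * scale] is -1 modulo
    [modulus]. *)
Lemma tval_mod i (j : int) f : exists q,
  code i f = 2 * scale * (res j)%:Z +
    (tval i j f %% modulus)%Z * 3 ^+ (n.+1 * res j) + q * modulus.
Proof.
have e1 : 3 ^+ (n.+1 * (K - res j)) * 3 ^+ (n.+1 * res j) = scale.
  by rewrite -exprD -mulnDr subnK// ltnW// res_lt.
have tE := divz_eq (tval i j f) modulus.
set k := (_ %% _)%Z in tE *; set Q := (_ %/ _)%Z in tE.
(* The first term undoes the reduction of [tval], the second the replacement of [- 2 * K * scale] by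
   1. *)
exists (Q * 3 ^+ (n.+1 * res j) +
  (code i f - 3 ^+ (n.+1 * res j) * lcode i j f - 2 * scale * (res j)%:Z)).
have -> : k = tval i j f - Q * modulus by rewrite {1}tE; ring.
rewrite /tval /modulus -e1; ring.
Qed.

Lemma scale_gt0 : 0 < scale.
Proof. exact: exprn_gt0. Qed.

Lemma modulus_gt0 : 0 < modulus.
Proof. by have := scale_gt0; rewrite /modulus; nia. Qed.

Lemma lcode_diff_lt i (j : int) f g :
  (forall x, blk x = j -> -1 <= cell f x - cell g x <= 1) ->
  - 3 ^+ n.+1 < lcode i j f - lcode i j g < 3 ^+ n.+1.
Proof.
move=> fg; rewrite -sumrB; under eq_bigr do rewrite -mulrBr.
have [||x xj|x|lt _] := @ternary_sum _ (block j) (dig i)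
  (fun x => cell f x - cell g x) n.+1.
- exact: interval_uniq.
- move=> x y; rewrite !(mem_block n_gt0) => /eqP xj /eqP yj /(dig_inj n_gt0).
  by apply: (pos_inj n_gt0); rewrite xj yj.
- by rewrite ltnS dig_le.
- by rewrite (mem_block n_gt0) => /eqP; exact: fg.
by move: lt; move: (\sum_(_ <- _) _) (3 ^+ _) => u v; lia.
Qed.

(** A change of quotient would jump over the 3^(n+1) residues reserved for walls, farther than
    [lcode_diff_lt] allows. *)
Lemma tval_div_eq i (j : int) f g : (forall x, blk x != j -> ev f x = ev g x) ->
  (forall x, blk x = j -> -1 <= cell f x - cell g x <= 1) ->
  3 ^+ n.+1 <= (tval i j f %% modulus)%Z ->
  3 ^+ n.+1 <= (tval i j g %% modulus)%Z ->
  (tval i j f %/ modulus)%Z = (tval i j g %/ modulus)%Z.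
Proof.
move=> fg /(lcode_diff_lt i); rewrite -(tval_sub i fg).
have P0 := modulus_gt0.
have ltP m : (m %% modulus)%Z < modulus by exact: ltz_pmod.
have := ltP (tval i j g); have := ltP (tval i j f).
move: (divz_eq (tval i j f) modulus) (divz_eq (tval i j g) modulus).
move: (tval i j f) (tval i j g) (_ %/ _)%Z (_ %/ _)%Z (_ %% _)%Z (_ %% _)%Z.
move: modulus (3 ^+ n.+1) {ltP} P0 => P M P0 t t' q q' m m' -> -> *.
by nia.
Qed.

(** Equal quotients keep the change of every [lcode] below [modulus]. The values of [lcode] for
    [pos x] and for [n] differ by the cell value at [x] times 3^n - 3^(pos x), which is at least
    1. *)
Lemma tval_div_bound (j : int) f g : (forall x, blk x != j -> ev f x = ev g x) ->
  (forall i, (i <= n)%N -> (tval i j f %/ modulus)%Z = (tval i j g %/ modulus)%Z) ->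
  forall x, blk x = j -> - (2 * modulus) < cell f x - cell g x < 2 * modulus.
Proof.
move=> fg tfg x xj.
have P0 := modulus_gt0.
have lt i : (i <= n)%N -> - modulus < lcode i j f - lcode i j g < modulus.
  move=> /tfg; rewrite -(tval_sub i fg).
  have lP m : (m %% modulus)%Z < modulus by exact: ltz_pmod.
  have gP m : 0 <= (m %% modulus)%Z by apply: modz_ge0; lia.
  have := lP (tval i j g); have := lP (tval i j f).
  have := gP (tval i j g); have := gP (tval i j f).
  move: (divz_eq (tval i j f) modulus) (divz_eq (tval i j g) modulus).
  move: (tval i j f) (tval i j g) (_ %/ _)%Z (_ %/ _)%Z (_ %% _)%Z (_ %% _)%Z.
  by move: modulus => P t t' q q' m m' -> -> *; lia.
have [_ xn] := blk_pos n_gt0 x.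
have := lt n (leqnn n); have := lt _ (ltnW xn).
have lE h : lcode (pos x) j h = lcode n j h + (3 ^+ n - 3 ^+ pos x) * cell h x.
  rewrite /lcode !(bigD1_seq x) ?interval_uniq ?(mem_block n_gt0) ?xj//=.
  have -> : dig (pos x) x = n by rewrite /dig eqxx.
  have -> : dig n x = pos x by rewrite /dig ltn_eqF.
  suff -> : \sum_(y <- block j | y != x) 3 ^+ dig (pos x) y * cell h y =
            \sum_(y <- block j | y != x) 3 ^+ dig n y * cell h y by ring.
  rewrite big_seq_cond [RHS]big_seq_cond; apply: eq_bigr => y /andP[].
  rewrite (mem_block n_gt0) => /eqP yj yx; have [_ yn] := blk_pos n_gt0 y.
  rewrite /dig (ltn_eqF yn) ifN//; apply: contra yx => /eqP yx.
  by apply/eqP/(pos_inj n_gt0); rewrite ?yj ?xj.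
rewrite !lE; have : 3 ^+ pos x + 1 <= 3 ^+ n :> int.
  have : 3 ^+ (pos x).+1 <= 3 ^+ n :> int by rewrite ler_weXn2l.
  by have : 1 <= 3 ^+ pos x :> int; [exact: exprn_ege1|rewrite exprS; lia].
move: (3 ^+ pos x) (3 ^+ n) (lcode n j f) (lcode n j g) => u v a b.
move: (cell f x) (cell g x) => c d.
by nia.
Qed.

(** The difference [D] of the codes is less than half of [scale] in absolute value. If the residues
    of the blocks differed, so would the offsets, by an amount at least [2 * scale] away from every
    multiple of [modulus], and the terms in [k] make up for less than [scale] of it. Hence the
    blocks agree, [D] is a multiple of [modulus], so it is 0, and [ternary_sum] applies. *)
Lemma code_separates i (k j j' : int) f g : (`|(j' - j)%R| <= R)%N ->
  (forall x, x \notin window j -> ev f x = ev g x) ->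
  (forall x, -1 <= cell f x - cell g x <= 1) ->
  0 <= k < 3 ^+ n.+1 ->
  (tval i j f %% modulus)%Z = k -> (tval i j' g %% modulus)%Z = k ->
  j = j' /\ forall x, x \in window j -> cell f x = cell g x.
Proof.
move=> jj' fg fg1 k0 tf tg.
have [q] := tval_mod i j f; have [q'] := tval_mod i j' g.
rewrite {}tf {}tg => gE fE.
have := code_sub i (interval_uniq _ _) fg.
have [||x _|x _|] := @ternary_sum _ (window j) (expo i)
  (fun x => cell f x - cell g x) (n.+1 * K).
- exact: interval_uniq.
- exact: expo_inj.
- exact: expo_lt.
- exact: fg1.
rewrite -/scale; move: (\sum_(_ <- _) _) => D Dlt D0 fgD.
have S0 := scale_gt0; have rj := res_lt j; have rj' := res_lt j'.
have kB e : (e < K)%N -> 0 <= k * 3 ^+ (n.+1 * e) < scale.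
  move=> eK; have B0 : 0 < 3 ^+ (n.+1 * e) :> int by exact: exprn_gt0.
  suff : 3 ^+ n.+1 * 3 ^+ (n.+1 * e) <= scale by nia.
  by rewrite -exprD ler_weXn2l// -mulnS leq_mul2l.
have DE : D = 2 * scale * ((res j)%:Z - (res j')%:Z) +
  (k * 3 ^+ (n.+1 * res j) - k * 3 ^+ (n.+1 * res j')) + (q - q') * modulus.
  by rewrite -fgD fE gE; ring.
have [ee|ee] := eqVneq (res j) (res j').
  have {jj'} <- : j = j'.
    by apply: (res_inj _ jj' ee); rewrite subrr.
  split=> // x xj; suff : D = 0 by move/D0/(_ x xj); lia.
  move: DE; rewrite ee !subrr mulr0 !add0r /modulus => DE.
  suff qq : q - q' = 0 by rewrite DE qq mul0r.
  by move: DE Dlt S0; rewrite /K; move: scale (q - q') => S d; clear; nia.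
exfalso; move: (kB _ rj) (kB _ rj') DE Dlt; rewrite /modulus.
move: (k * _) (k * _) (q - q') S0 => u v d S0.
move: ee rj rj'; move: (res j) (res j') K scale S0 => a b K' S S0 ab aK bK hu hv DE hD.
pose w : int := S * (a%:Z - b%:Z); pose z : int := S * K'%:Z.
have hw : S <= w <= z - S \/ S - z <= w <= - S.
  by rewrite /w /z; have [ltab|leba] := ltnP a b; [right|left]; nia.
have {DE} DE : D = 2 * w + (v - u) + d * (1 + 2 * z) by rewrite DE /w /z; ring.
have hz : S <= z by rewrite /z; nia.
have : d = 0 \/ d * (1 + 2 * z) >= 1 + 2 * z \/ d * (1 + 2 * z) <= - (1 + 2 * z).
  have : d = 0 \/ 1 <= d \/ d <= -1 by lia.
  by case=> [|[]] h; [left|right; left; nia|right; right; nia].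
move: w z hw hz DE => w z hw hz DE [d0|hd]; first by rewrite d0 mul0r in DE; lia.
by move: (d * _) DE hd => y; lia.
Qed.
End Coding.

(** * Controlled covers *)

(** A disjoint bounded family is encoded by labelling points: its members are the fibres of [key] on
    [A]. *)
Definition separated (N : nat) (A : wreathZ -> Prop) : Prop :=
  exists (T : Type) (key : wreathZ -> T) (B : nat),
    (forall u v, A u -> A v -> (gap u v < N)%N -> key u = key v) /\
    (forall u v, A u -> A v -> key u = key v -> (gap u v <= B)%N).

Lemma separated0 N : separated N (fun=> False).
Proof. by exists unit, (fun=> tt), 0%N. Qed.

Lemma gap_translate c u v : gap (wr_mul c u) (wr_mul c v) = gap u v.
Proof.
have e : ((c * u)^-1 * (c * v) = u^-1 * v :> wreathZ)%g by rewrite invgM -mulgA mulKg.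
exact: (congr1 len e).
Qed.

Lemma separated_translate c N A :
  separated N A -> separated N (fun u => A (wr_mul c u)).
Proof.
move=> [T [key [B [sepA bdA]]]]; exists T, (fun u => key (wr_mul c u)), B.
by split=> u v Au Av; rewrite -(gap_translate c); [exact: sepA|exact: bdA].
Qed.

(** * Tame points and walls *)

Section HalfCover.
Variable r : nat.
Hypothesis r_gt0 : (0 < r)%N.
Let n := (4 * r)%N.
Let n_gt0 : (0 < n)%N. Proof. by rewrite muln_gt0. Qed.
Local Notation blk := (blk n).
Local Notation pos := (pos n).

Definition central (a : int) : bool := (r <= pos a < 3 * r)%N.

Lemma central_near a x : central a -> (`|(x - a)%R| < r)%N -> blk x = blk a.
Proof.
move=> /andP[ra ar] xa; apply/eqP; rewrite blkP//.
have [aE _] := blk_pos n_gt0 a; move: ra ar aE.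
by move: (pos a) (blk a * n%:Z) => p q; rewrite /n; lia.
Qed.

(** A shift by half the length of a block carries the first and last quarters of blocks into the
    central halves. *)
Lemma central_cover a : central a \/ central (a - (2 * r)%N%:Z).
Proof.
have [aE an] := blk_pos n_gt0 a; rewrite /central.
have [bE bn] := blk_pos n_gt0 (a - (2 * r)%N%:Z).
move: (blk a) (blk (_ - _)) (pos a) (pos (_ - _)) aE an bE bn => p q x y aE an bE bn.
have {aE bE} e : 4 * (r%:Z * (p - q)) = (2 * r)%N%:Z + y%:Z - x%:Z.
  have -> : 4 * (r%:Z * (p - q)) = p * n%:Z - q * n%:Z by rewrite /n PoszM; ring.
  by move: aE bE; move: (p * _) (q * _) => P Q; lia.
have [d|[d|[d|d]]] : p - q <= -1 \/ p - q = 0 \/ p - q = 1 \/ 2 <= p - q by lia.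
- have : r%:Z * (p - q) <= r%:Z * -1 by rewrite ler_wpM2l.
  by move: e an bn; move: (_ * (p - q)) => w; rewrite /n; lia.
- by move: e an bn; rewrite d /n; lia.
- by move: e an bn; rewrite d /n; lia.
- have : r%:Z * 2 <= r%:Z * (p - q) by rewrite ler_wpM2l.
  by move: e an bn; move: (_ * (p - q)) => w; rewrite /n; lia.
Qed.

Variable R : nat.
Let s := (r + R)%N.
Let s_gt0 : (0 < s)%N. Proof. by rewrite addn_gt0 r_gt0. Qed.
Local Notation tval := (tval n R s).
Local Notation modulus := (modulus n R).
Local Notation cell := (cell s).

Definition tame (u : wreathZ) : Prop := central u.2 /\
  forall i, (i <= n)%N -> 3 ^+ n.+1 <= (tval i (blk u.2) u.1 %% modulus)%Z.

Definition wall (i k : nat) (u : wreathZ) : Prop :=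
  (k < 3 ^ n.+1)%N /\ (tval i (blk u.2) u.1 %% modulus)%Z = k%:Z.

Lemma separated_tame : separated r tame.
Proof.
(* At scale [r] nothing changes outside the block, so the lamps there can serve as labels; inside,
   only the quotients are recorded. *)
pose key (u : wreathZ) := (blk u.2,
  fun x => if blk x == blk u.2 then 0 else ev u.1 x,
  fun i => if (i <= n)%N then (tval i (blk u.2) u.1 %/ modulus)%Z else 0).
have [B Bgap] := gap_bounded n ((`|(2 * modulus)%R|).+1 * s).
exists _, key, B; split=> -[f a] [g b] [/= ca fa] [/= cb gb].
  move=> gapr; have [ab fg fga] := gap_bounds (leqnn (gap (f, a) (g, b))).
  have jE : blk b = blk a.
    by apply: central_near => //; rewrite -abszN opprB; exact: leq_ltn_trans gapr.
  have fgo x : blk x != blk a -> ev f x = ev g x.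
    move=> xa; apply/eqP; apply: contraNT xa => /fga xa; apply/eqP.
    by apply: central_near => //; exact: leq_ltn_trans gapr.
  rewrite /key /= jE; congr (_, _, _).
    by apply/funext => x; case: ifPn => // /fgo.
  apply/funext => i; case: ifPn => // ni; apply: (tval_div_eq n_gt0) => //.
  - by move=> x _; apply: (cell_adjacent s_gt0); have := fg x; rewrite /s; lia.
  - exact: fa.
  - by rewrite -jE; exact: gb.
rewrite /key /= => -[jE out tE].
have fgo x : blk x != blk a -> ev f x = ev g x.
  by move=> xa; have := congr1 (@^~ x) out; rewrite /= -jE (negbTE xa).
have Pbd x : blk x = blk a -> - (2 * modulus) < cell f x - cell g x < 2 * modulus.
  apply: (tval_div_bound n_gt0) => // i ni.
  by have := congr1 (@^~ i) tE; rewrite /= ni -jE.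
apply: Bgap => [|x|x].
- exact: (blk_eq_close n_gt0).
- have [xa|/fgo ->] := eqVneq (blk x) (blk a); last by rewrite subrr.
  by apply: (cell_close s_gt0); have := Pbd _ xa; lia.
- have [xa _|/fgo ->] := eqVneq (blk x) (blk a); last by rewrite eqxx.
  exact: (blk_eq_close n_gt0).
Qed.

Lemma separated_wall i k : separated R (wall i k).
Proof.
(* At scale [R] lamps may change throughout the window, so only their cells are recorded there;
   [code_separates] makes these constant. *)
pose key (u : wreathZ) := (blk u.2,
  fun x => if x \in window n R (blk u.2) then cell u.1 x else ev u.1 x).
have [B Bgap] := gap_bounded (R.+1 * n) s.
exists _, key, B; split=> -[f a] [g b] [/= km fa] [/= _ gb].
  move=> gapR; have [ab fg fga] := gap_bounds (leqnn (gap (f, a) (g, b))).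
  have fgo x : x \notin window n R (blk a) -> ev f x = ev g x.
    move=> xa; apply/eqP; apply: contraNT xa => /fga xa.
    by rewrite mem_window//; apply: (blk_close n_gt0); lia.
  have jj : (`|(blk b - blk a)%R| <= R)%N.
    by apply: (blk_close n_gt0); lia.
  have c1 x : -1 <= cell f x - cell g x <= 1.
    by apply: (cell_adjacent s_gt0); have := fg x; rewrite /s; lia.
  have k0 : 0 <= k%:Z < 3 ^+ n.+1 by rewrite -natrX; lia.
  have [jE cfg] := code_separates n_gt0 jj fgo c1 k0 fa gb.
  rewrite /key /= -jE; congr pair.
  by apply/funext => x; case: ifPn => [/cfg|/fgo].
rewrite /key /= => -[jE out].
have out1 x := congr1 (@^~ x) out; rewrite /= -jE in out1.
apply: Bgap => [|x|x].
- by apply: leq_trans (blk_eq_close n_gt0 jE) _; rewrite leq_pmull.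
- have := out1 x; case: ifPn => [_ cE|_ ->]; last by rewrite subrr.
  by have := @cell_close _ s_gt0 0 f g x; rewrite cE subrr mul1n; apply.
- have := out1 x; case: ifPn => [+ _|_ ->]; last by rewrite eqxx.
  rewrite mem_window// => xa _; have [xE xn] := blk_pos n_gt0 x.
  have [aE an] := blk_pos n_gt0 a; rewrite {1}xE {1}aE.
  move: xa.
  move: (blk x) (blk a) (pos x) (pos a) xn an => p q y z.
  by move: n n_gt0 => l l0 yl zl *; nia.
Qed.

Lemma tame_or_wall u : central u.2 ->
  tame u \/ exists i k, [/\ (i <= n)%N, (k < 3 ^ n.+1)%N & wall i k u].
Proof.
move=> cu; have [tu|ntu] := pselect (tame u); [by left|right].
have P0 : modulus != 0 by rewrite gt_eqF ?modulus_gt0.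
have [i [ni ti]] : exists i, (i <= n)%N /\
    (tval i (blk u.2) u.1 %% modulus)%Z < 3 ^+ n.+1.
  apply: contrapT => nex; apply: ntu; split=> // i ni.
  by rewrite leNgt; apply/negP => ti; apply: nex; exists i.
have t0 := modz_ge0 (tval i (blk u.2) u.1) P0.
have k3 : (`|(tval i (blk u.2) u.1 %% modulus)%Z| < 3 ^ n.+1)%N.
  by move: ti; rewrite -natrX; lia.
by exists i, `|(tval i (blk u.2) u.1 %% modulus)%Z|%N; split=> //; split=> //; lia.
Qed.

End HalfCover.

Lemma controlled_cover (r : nat) : (0 < r)%N ->
  exists m : nat, forall R : nat, exists C : nat -> wreathZ -> Prop,
    (forall k, separated (if (k < 2)%N then r else R) (C k)) /\
    forall u, exists2 k, (k < m.+2)%N & C k u.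
Proof.
move=> r_gt0; pose n := (4 * r)%N.
pose I : finType := ('I_n.+1 * 'I_(3 ^ n.+1) * bool)%type.
(* The number of walls depends on [r] alone; the boolean selects original or translated
   positions. *)
exists #|I| => R.
pose back (u : wreathZ) := wr_mul (0, - (2 * r)%N%:Z) u.
pose W (t : I) (u : wreathZ) :=
  wall r R t.1.1 t.1.2 (if t.2 then back u else u).
pose C k (u : wreathZ) := match k with
  | 0 => tame r R u
  | 1 => tame r R (back u)
  | k'.+2 => if insub k' is Some o then W (enum_val (o : 'I_#|I|)) u else False
  end.
exists C; split=> [[|[|k]]|u] /=.
- exact: separated_tame.
- exact/separated_translate/separated_tame.
- rewrite /C; case: (insub k : option 'I_#|I|) => [t|]; last exact: separated0.
  rewrite /W; case: (enum_val t).2; last exact: separated_wall.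
  exact/separated_translate/separated_wall.
have CW (t : I) : W t u -> exists2 k, (k < #|I|.+2)%N & C k u.
  move=> Wt; exists (enum_rank t).+2; first by rewrite !ltnS.
  by rewrite /C valK enum_rankK.
have [cu|cu] := central_cover r_gt0 u.2.
- have [tu|[i [k [ni k3 wu]]]] := tame_or_wall r_gt0 R cu; first by exists 0%N.
  by apply: (CW (@Ordinal n.+1 i ni, Ordinal k3, false)).
- have [|tu|[i [k [ni k3 wu]]]] := tame_or_wall r_gt0 R (u := back u).
  + by rewrite /back/= addrC.
  + by exists 1%N.
  by apply: (CW (@Ordinal n.+1 i ni, Ordinal k3, true)).
Qed.

(** * Transfinite asymptotic dimension *)

Local Open Scope classical_set_scope.
Local Open Scope ring_scope.

Section Families.
Variable R : realType.
Let X : metricType R := word_space R wr_gens_generate.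

Lemma mdist_gap (u v : X) : mdist u v = (gap u v)%:R.
Proof. by []. Qed.

Lemma separated_family N (A : wreathZ -> Prop) : separated N A ->
  exists F : set (set X),
    [/\ uniformly_bounded F, disjoint_family N%:R F
      & forall u : X, A u -> exists2 V, F V & V u].
Proof.
move=> [T [key [B [sepA bdA]]]].
exists (range (fun t : T => [set u : X | A u /\ key u = t])); split.
(* [B] may be 0, whereas the bound must be positive. *)
- exists B.+1%:R => // _ [t _ <-]; apply: ge_ereal_sup => _ [u [Au <-]] [v [Av vt]] <-.
  by rewrite lee_fin mdist_gap ler_nat leqW// bdA.
- move=> _ _ [t _ <-] [t' _ <-] tt'; apply: le_ereal_inf_tmp.
  move=> _ [u [Au ut]] [v [Av vt]] <-.
  rewrite lee_fin mdist_gap ler_nat leqNgt; apply/negP => /(sepA _ _ Au Av).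
  by rewrite ut vt => tt''; apply: tt'; rewrite tt''.
- by move=> u Au; exists [set v : X | A v /\ key v = key u] => //; exists (key u).
Qed.

Lemma disjoint_family_le (a b : R) (F : set (set X)) :
  a <= b -> disjoint_family b F -> disjoint_family a F.
Proof.
move=> ab Fb U V FU FV UV; apply: le_trans (Fb U V FU FV UV).
by rewrite lee_fin.
Qed.

Lemma controlled_families (r : nat) : (0 < r)%N ->
  exists m : nat, forall q : nat, exists F : nat -> set (set X),
    [/\ forall k, uniformly_bounded (F k),
        forall k, disjoint_family (if (k < 2)%N then r else q)%:R (F k)
      & forall u : X, exists2 k, (k < m.+2)%N & exists2 V, F k V & V u].
Proof.
move=> /controlled_cover[m cover]; exists m => q.
have [C [sepC covC]] := cover q.
have [F FP] := choice (fun k => separated_family (sepC k)).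
exists F; split=> [k|k|u]; [by have [] := FP k|by have [] := FP k|].
have [k km Cku] := covC u; exists k => //.
by have [_ _ covF] := FP k; exact: covF.
Qed.

Lemma controlled_asymptotic_property_C : asymptotic_property_C X.
Proof.
move=> r r_gt0 r_lt.
(* The first two families get a scale above [r 1], hence above [r 0]. Only then is [m] known, and
   [r m.+1] dominates all remaining entries. *)
have [m fam] := @controlled_families (Num.truncn (r 1%N)).+1 isT.
have [F [bdF disF covF]] := fam (Num.truncn (r m.+1)).+1.
have ler i j : (i <= j)%N -> r i <= r j.
  elim: j => [|j IH]; first by rewrite leqn0 => /eqP ->.
  by rewrite leq_eqVlt => /orP[/eqP ->//|/IH rij]; exact: le_trans rij (ltW (r_lt _)).
exists m.+1 => //; exists (fun i => F i); split=> [i|i|]; first exact: bdF.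
  apply: disjoint_family_le (disF i); case: ifPn => i2.
    by apply: le_trans (ler i 1%N i2) (ltW _); exact: truncnS_gt.
  by apply: le_trans (ler i m.+1 (ltn_ord i)) (ltW _); exact: truncnS_gt.
apply/seteqP; split=> // u _; have [k km [V FV Vu]] := covF u.
by exists (Ordinal km) => //; exists V.
Qed.

End Families.

(** Passing to a link lowers the bound on cardinalities by one; as members are nonempty, none is
    left at bound 0. *)
Lemma Ord_le_onat (m : nat) (M : set {fset nat}) :
  M `<=` FinN -> (forall t, M t -> (#|` t| <= m)%N) -> Ord_le M (onat m).
Proof.
elim: m M => [|m IH] M finM cardM.
  apply/Ord_le_zeroE/seteqP; split=> // t Mt.
  have [t0 _] := finM t Mt.
  by move: (cardM _ Mt); rewrite leqn0 cardfs_eq0 (negbTE t0).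
apply: Ord_le_pos; first by exists tt; exact: ole_zero.
move=> a a_gt0; exists (onat m); first by exists tt; exact: ole_refl.
apply: IH => [t []//|t [_ Mt at']].
by have := cardM _ Mt; rewrite cardfsU1 at'.
Qed.

Theorem theorem3p1 (R : realType) :
  trasdim_le (word_space R wr_gens_generate) (osucc omega) /\
  asymptotic_property_C (word_space R wr_gens_generate).
Proof.
split; last exact: controlled_asymptotic_property_C.
apply: Ord_le_pos; first by exists tt; exact: ole_zero.
(* The elements [a] and [b] are removed first. They fix the scale [a + b], and with it the number
   [m] bounding the size of whatever remains; as [m] varies with them, the second ordinal is
   [omega]. *)
move=> a a_gt0; exists omega; first by exists tt; exact: ole_refl.
apply: Ord_le_pos; first by exists 0%N; exact: ole_refl.
move=> b b_gt0; have ab_gt0 : (0 < a + b)%N by rewrite addn_gt0 a_gt0.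
have [m fam] := controlled_families R ab_gt0.
exists (onat m); first by exists m; exact: ole_refl.
apply: Ord_le_onat => [t []//|t [ft [_ [_ ncov] abt] bt]].
rewrite leqNgt; apply/negP => mt; apply: ncov.
have [F [bdF disF covF]] := fam (\max_(i <- t) i).
(* Listing [a] and [b] first assigns them the two families of scale [a + b]. *)
pose L := [:: a, b & t : seq nat].
have uL : uniq L.
  rewrite /= inE negb_or fset_uniq bt andbT -!andbA; move: abt.
  by rewrite !inE negb_or => /andP[-> ->].
have memL i : (i \in (a |` (b |` t))%fset) = (i \in L) by rewrite !inE.
exists (fun i => F (index i L)); split=> [i _|i|]; first exact: bdF.
  rewrite memL => iL; apply: disjoint_family_le (disF _).
  rewrite ler_nat; move: iL; rewrite !inE /=.
  have [<- _|ai] := eqVneq a i; first exact: leq_addr.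
  have [<- _|bi] := eqVneq b i; first exact: leq_addl.
  move=> /= it.
  by rewrite (big_rem i)//= leq_maxl.
apply/seteqP; split=> // u _; have [k km [V FV Vu]] := covF u.
have kL : (k < size L)%N by rewrite (leq_trans km)//= !ltnS ltnW.
by exists (nth 0%N L k); [rewrite /= memL mem_nth|exists V; rewrite ?index_uniq].
Qed.
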